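(* Let $k$ and $\ell$ be positive integers, and let $n$ be an integer with $n > \max(2k, 2\ell)$. Let $x$ and $z$ be positive real numbers such that \[ 0 < x+z < \frac{1}{k} \qquad\text{and}\qquad x+z \neq \frac{2}{n}, \] and let \[ y = \frac{x+z}{2} \qquad\text{and}\qquad w = \frac{1-k(x+z)}{n-2k}. \] Let $A$ be the $n \times n$ matrix whose $i$th row is \[ \mathrm{row}_i(A) = \begin{cases} (\underbrace{x,x,\ldots, x}_{k}, \underbrace{w,w,\ldots, w}_{n-2k}, \underbrace{z,z,\ldots, z}_{k}) & \text{if } i \in \{1,2,\ldots, \ell\},\\[2ex] (\underbrace{y,y,\ldots, y}_{k}, \underbrace{w,w,\ldots, w}_{n-2k}, \underbrace{y,y,\ldots, y}_{k}) & \text{if } i \in \{\ell+1, \ell + 2,\ldots, n -\ell\},\\[2ex] (\underbrace{z,z,\ldots, z}_{k}, \underbrace{w,w,\ldots, w}_{n-2k}, \underbrace{x,x,\ldots, x}_{k}) & \text{if } i \in \{n - \ell+1,n - \ell + 2,\ldots, n \}. \end{cases} \] Then $A$ is row stochastic but not column stochastic, and the matrix $A\,Y(A)$ obtained from $A$ after one column scaling is doubly stochastic.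
   Context: For an $n\times n$ real matrix $A = (a_{i,j})$, the $i$th row sum is $\mathrm{rowsum}_i(A) = \sum_{j=1}^n a_{i,j}$ and the $j$th column sum is $\mathrm{colsum}_j(A) = \sum_{i=1}^n a_{i,j}$. The matrix $A$ is row stochastic if all its entries are nonnegative and $\mathrm{rowsum}_i(A) = 1$ for all $i \in \{1,\ldots,n\}$; it is column stochastic if all its entries are nonnegative and $\mathrm{colsum}_j(A) = 1$ for all $j \in \{1,\ldots,n\}$; it is doubly stochastic if it is both row stochastic and column stochastic. For a nonnegative $n\times n$ matrix $A$ with all row sums and column sums positive, let $Y(A)$ be the $n\times n$ diagonal matrix \[ Y(A) = \mathrm{diag}\left( \frac{1}{\mathrm{colsum}_1(A)}, \ldots, \frac{1}{\mathrm{colsum}_n(A)} \right). \] Column scaling $A$ means replacing $A$ by $A\,Y(A)$, that is, dividing each entry of $A$ by the sum of the column containing it. *)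

(* Defs.v *)
From mathcomp Require Import all_boot all_order all_algebra.
From mathcomp Require Import reals.

Set Implicit Arguments.
Unset Strict Implicit.
Unset Printing Implicit Defensive.

Import Order.TTheory GRing.Theory Num.Theory.
Local Open Scope ring_scope.

Definition rowsum (R : realType) (n : nat) (A : 'M[R]_n) (i : 'I_n) : R :=
  \sum_(j < n) A i j.

Definition colsum (R : realType) (n : nat) (A : 'M[R]_n) (j : 'I_n) : R :=
  \sum_(i < n) A i j.

Definition nonneg_mx (R : realType) (n : nat) (A : 'M[R]_n) : Prop :=
  forall i j, 0 <= A i j.

Definition row_stochastic (R : realType) (n : nat) (A : 'M[R]_n) : Prop :=
  nonneg_mx A /\ forall i, rowsum A i = 1.

Definition column_stochastic (R : realType) (n : nat) (A : 'M[R]_n) : Prop :=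
  nonneg_mx A /\ forall j, colsum A j = 1.

Definition doubly_stochastic (R : realType) (n : nat) (A : 'M[R]_n) : Prop :=
  row_stochastic A /\ column_stochastic A.

(* Since 1 / 0 = 0, this is total; it is the column scaling matrix only when
   no column sum of A vanishes. If one does vanish, the corresponding column of
   A *m colscale_mx A is zero, so that product is not column stochastic. *)
Definition colscale_mx (R : realType) (n : nat) (A : 'M[R]_n) : 'M[R]_n :=
  diag_mx (\row_(j < n) (1 / colsum A j)).

(* The row (a, .., a, b, .., b, c, .., c) with k entries a, n - 2k entries b
   and k entries c, for 2k <= n. *)
Definition block_row (R : realType) (n k : nat) (a b c : R) : 'rV[R]_n :=
  \row_(j < n) if (j < k)%N then a else if (j < n - k)%N then b else c.

(* Indices in 'I_n start at 0: the first l rows are those with i < l, and the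
   last l rows those with n - l <= i. *)
Definition block_matrix (R : realType) (n k l : nat) (x y z w : R) : 'M[R]_n :=
  \matrix_(i < n)
    if (i < l)%N then block_row n k x w z
    else if (i < n - l)%N then block_row n k y w y
    else block_row n k z w x.

(* Main.v *)
Require Import Defs.
From mathcomp Require Import all_boot all_order all_algebra.
From mathcomp Require Import reals.
From mathcomp Require Import ring lra.

Set Implicit Arguments.
Unset Strict Implicit.
Unset Printing Implicit Defensive.

Import Order.TTheory GRing.Theory Num.Theory.
Local Open Scope ring_scope.

(** Since [x + z = 2 y], every row of the block matrix has the same sum
    [2 k y + (n - 2 k) w], which is [1] by the choice of [w], while each of
    the [2 k] outer columns sums to [n y] and each of the [n - 2 k] middle
    columns sums to [n w] ([rowsum_block_matrix], [colsum_block_matrix]).  The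
    outer column sums differ from [1] because [x + z != 2 / n].

    Column scaling divides the outer columns by [n y] and the middle ones by
    [n w], so that [y] and [w] both become [1 / n]: the result is again a block
    matrix ([block_matrix_scale]), with parameters [x / (n y)], [1 / n],
    [z / (n y)], [1 / n].  These satisfy the same relation
    [x' + z' = 2 y'], so the formulas for the row and column sums apply again
    and all the sums are [1]. *)

Lemma sum_blocks (V : nmodType) (n m : nat) (a b c : V) :
  (2 * m <= n)%N ->
  \sum_(j < n) (if (j < m)%N then a else if (j < n - m)%N then b else c)
    = a *+ m + b *+ (n - 2 * m) + c *+ m.
Proof.
move=> le_2m_n; have [p ->] : exists p, n = (m + p + m)%N.
  by exists (n - 2 * m)%N; rewrite addnAC addnn -mul2n subnKC.
have -> : (m + p + m - 2 * m = p)%N by rewrite addnAC addnn -mul2n addKn.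
rewrite addnK !big_split_ord /=; congr (_ + _ + _).
- rewrite -[in RHS](card_ord m) -sumr_const.
  by apply: eq_bigr => i _; rewrite ltn_ord.
- rewrite -[in RHS](card_ord p) -sumr_const; apply: eq_bigr => i _.
  by rewrite ltnNge leq_addr ltn_add2l ltn_ord.
- rewrite -[in RHS](card_ord m) -sumr_const; apply: eq_bigr => i _.
  by rewrite ltnNge -addnA leq_addr addnA ltnNge leq_addr.
Qed.

Section BlockMatrix.

Variables (R : realType) (n k l : nat).
Implicit Types x y z w : R.

Lemma block_matrixE x y z w i j :
  block_matrix n k l x y z w i j =
    if (i < l)%N then block_row n k x w z 0 j
    else if (i < n - l)%N then block_row n k y w y 0 j
    else block_row n k z w x 0 j.
Proof. by rewrite mxE; case: ifP => // _; case: ifP. Qed.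

Lemma block_matrix_ge0 x y z w :
  0 <= x -> 0 <= y -> 0 <= z -> 0 <= w ->
  nonneg_mx (block_matrix n k l x y z w).
Proof.
by move=> x0 y0 z0 w0 i j; rewrite block_matrixE !mxE; do !case: ifP.
Qed.

Lemma rowsum_block_matrix x y z w i :
  (2 * k <= n)%N -> x + z = 2 * y ->
  rowsum (block_matrix n k l x y z w) i =
    2 * k%:R * y + (n%:R - 2 * k%:R) * w.
Proof.
move=> le_2k_n xzE; have zE : z = 2 * y - x by rewrite -xzE addrC addKr.
have sumE a b c : \sum_(j < n) block_row n k a b c 0 j =
    a * k%:R + b * (n%:R - 2 * k%:R) + c * k%:R.
  under eq_bigr do rewrite mxE.
  rewrite sum_blocks // -(mulr_natr a) -(mulr_natr b) -(mulr_natr c).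
  by rewrite natrB // natrM.
rewrite /rowsum; under eq_bigr do rewrite block_matrixE.
by case: (i < l)%N; [|case: (i < n - l)%N]; rewrite sumE ?zE; ring.
Qed.

Lemma colsum_block_matrix x y z w j :
  (2 * l <= n)%N -> x + z = 2 * y ->
  colsum (block_matrix n k l x y z w) j = n%:R * block_row n k y w y 0 j.
Proof.
move=> le_2l_n xzE; have zE : z = 2 * y - x by rewrite -xzE addrC addKr.
rewrite /colsum; under eq_bigr do rewrite block_matrixE.
rewrite sum_blocks // !mxE -[_ *+ (n - _)]mulr_natr natrB // natrM.
by case: ifP => _; [|case: ifP => _]; rewrite ?zE; ring.
Qed.

Lemma block_matrix_scale x y z w :
  (2 * l <= n)%N -> x + z = 2 * y -> y != 0 -> w != 0 ->
  block_matrix n k l x y z w *m colscale_mx (block_matrix n k l x y z w) =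
    block_matrix n k l (x / (n%:R * y)) (1 / n%:R) (z / (n%:R * y)) (1 / n%:R).
Proof.
move=> le_2l_n xzE y0 w0; apply/matrixP => i j.
have n0 : n%:R != 0 :> R.
  by rewrite pnatr_eq0 -lt0n (leq_ltn_trans _ (ltn_ord i)).
rewrite mul_mx_diag mxE [X in _ * X]mxE colsum_block_matrix // !block_matrixE.
by rewrite !mxE; do !case: ifP => _; field; rewrite ?n0 ?y0 ?w0.
Qed.

End BlockMatrix.

Theorem theorem1 (R : realType) (k l n : nat) (x y z w : R)
    (hk : (0 < k)%N) (hl : (0 < l)%N) (hn : (maxn (2 * k) (2 * l) < n)%N)
    (hx : 0 < x) (hz : 0 < z)
    (hxz : 0 < x + z < 1 / k%:R) (hxzn : x + z != 2 / n%:R)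
    (hy : y = (x + z) / 2)
    (hw : w = (1 - k%:R * (x + z)) / (n%:R - 2 * k%:R)) :
  let A := block_matrix n k l x y z w in
  row_stochastic A /\ ~ column_stochastic A /\
  doubly_stochastic (A *m colscale_mx A).
Proof.
move=> A; move: hn; rewrite gtn_max => /andP[lt_2k_n lt_2l_n].
have n_gt0 : (0 < n)%N by apply: leq_ltn_trans lt_2k_n.
have nR_gt0 : 0 < n%:R :> R by rewrite ltr0n.
have nR_neq0 : n%:R != 0 :> R by rewrite lt0r_neq0.
have n2k_gt0 : 0 < n%:R - 2 * k%:R :> R by rewrite subr_gt0 -natrM ltr_nat.
have n2k_neq0 : n%:R - 2 * k%:R != 0 :> R by rewrite lt0r_neq0.
have xzE : x + z = 2 * y by rewrite hy; field.
have y_gt0 : 0 < y by rewrite hy; lra.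
have w_gt0 : 0 < w.
  rewrite hw divr_gt0 // subr_gt0 mulrC -ltr_pdivlMr ?ltr0n //.
  by case/andP: hxz.
have sum1 : 2 * k%:R * y + (n%:R - 2 * k%:R) * w = 1 by rewrite hw hy; field.
have [y_neq0 w_neq0] : y != 0 /\ w != 0 by rewrite !lt0r_neq0.
split; first split.
- by apply: block_matrix_ge0; apply: ltW.
- by move=> i; rewrite rowsum_block_matrix // ltnW.
split.
  case=> _ /(_ (Ordinal n_gt0)); rewrite colsum_block_matrix ?(ltnW lt_2l_n) //.
  rewrite !mxE /= hk => ny1; case/eqP: hxzn.
  by apply: (mulfI nR_neq0); rewrite xzE mulrCA ny1; field.
rewrite block_matrix_scale ?(ltnW lt_2l_n) //.
have xzE' : x / (n%:R * y) + z / (n%:R * y) = 2 * (1 / n%:R).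
  by rewrite -mulrDl xzE; field; rewrite nR_neq0 y_neq0.
have nn : nonneg_mx (block_matrix n k l (x / (n%:R * y)) (1 / n%:R)
                       (z / (n%:R * y)) (1 / n%:R)).
  by apply: block_matrix_ge0; rewrite ?divr_ge0 ?mulr_ge0 // ltW.
split; split=> //.
  by move=> i; rewrite rowsum_block_matrix ?(ltnW lt_2k_n) //; field.
move=> j; rewrite colsum_block_matrix ?(ltnW lt_2l_n) // !mxE.
by do !case: ifP => _; field.
Qed.
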